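(* There exist universal constants $C_1,C_2>0$ (in particular not depending on $\alpha$, $t$, and the $X_i$) such that the following holds. Let $\alpha\ge1$, let $\beta$ satisfy $\frac1\alpha+\frac1\beta=1$, let $X_1,\dots,X_n$ be independent mean-zero real random variables with $\|X_i\|_{\Psi_\alpha}<\infty$, and let $a_1,\dots,a_n$ be any real scalars. Then for all $t\ge0$: if $\alpha\ge2$, $$\mathbb P\left(\left|\sum_{i=1}^n a_iX_i\right|\ge t\right)\le 2\exp\left(-C_1\max\left\{\frac{t^2}{\sum_{i=1}^n a_i^2\|X_i\|_{\Psi_\alpha}^2},\frac{t^\alpha}{\left(\sum_{i=1}^n|a_i|^\beta\|X_i\|_{\Psi_\alpha}^\beta\right)^{\alpha/\beta}}\right\}\right),$$ and if $1\le\alpha\le2$, $$\mathbb P\left(\left|\sum_{i=1}^n a_iX_i\right|\ge t\right)\le 2\exp\left(-C_2\min\left\{\frac{t^2}{\sum_{i=1}^n a_i^2\|X_i\|_{\Psi_\alpha}^2},\frac{t^\alpha}{\left(\sum_{i=1}^n|a_i|^\beta\|X_i\|_{\Psi_\alpha}^\beta\right)^{\alpha/\beta}}\right\}\right).$$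
   Context: For a real random variable $X$ and $\alpha\ge1$, the Orlicz norm is $\|X\|_{\Psi_\alpha}:=\inf\{u>0:\ \mathbb E\exp((|X|/u)^\alpha)\le 2\}$. When $\alpha=1$, $\beta=\infty$ and $(\sum_{i=1}^n|a_i|^\beta\|X_i\|_{\Psi_1}^\beta)^{1/\beta}$ means $\max_{i}|a_i|\|X_i\|_{\Psi_1}$. *)

(* Defs.v *)
From HB Require Import structures.
From mathcomp Require Export all_boot all_order all_algebra.
From mathcomp Require Export all_classical all_reals all_analysis.

Set Implicit Arguments.
Unset Strict Implicit.
Unset Printing Implicit Defensive.

Export Order.TTheory GRing.Theory Num.Theory.
Export numFieldNormedType.Exports.

Local Open Scope classical_set_scope.
Local Open Scope ring_scope.
Local Open Scope ereal_scope.

(* Extended-real valued: the infimum of the empty set is +oo. *)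
Definition orlicz_norm d (T : measurableType d) (R : realType)
    (P : probability T R) (alpha : R) (X : T -> R) : \bar R :=
  ereal_inf [set u%:E | u in
    [set u : R | (0 < u)%R /\
      'E_P[fun w => expR ((`|X w| / u) `^ alpha)%R] <= 2%:E]].

(* Mutual independence: the product rule over every finite subfamily. *)
Definition independent_RVs d (T : measurableType d) (R : realType)
    (P : probability T R) (I : finType) (X : I -> {RV P >-> R}) : Prop :=
  forall (J : {set I}) (B : I -> set R),
    (forall i, measurable (B i)) ->
    P (\bigcap_(i in [set i | i \in J]) (X i @^-1` B i)) =
    \prod_(i in J) P (X i @^-1` B i).

(* The quantity (\sum_i |a_i|^beta x_i^beta)^(1/beta) for x_i >= 0, read as
   \max_i |a_i| x_i when beta = +oo. The value at -oo is junk: the equation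
   1/alpha + 1/beta = 1 has no solution beta = -oo, since (-oo)^-1 = -oo. *)
Definition weighted_lnorm (R : realType) (beta : \bar R) (n : nat)
    (a x : 'I_n -> R) : R :=
  match beta with
  | b%:E => ((\sum_(i < n) `|a i| `^ b * x i `^ b) `^ b^-1)%R
  | +oo => (\big[Num.max/0]_(i < n) (`|a i| * x i))%R
  | -oo => 0%R
  end.

(* Main.v *)
Require Import Defs.
From mathcomp Require Import measurable_realfun ring lra.

(** The proof is Chernoff's method; all the work is to bound the moment
generating function of one variable with constants that do not depend on
[alpha]. Put [b = alpha / (alpha - 1)], let [K] be the Orlicz norm of the
centred variable [X], and let [s = l K].

A bound [expR (s z) <= A + c z + B expR (|z|^alpha)], valid for all real [z],
integrates at [z = X / u] to [E exp (l X) <= A + 2 B] for [s = l u], because the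
linear term has mean zero and [E exp (|X / u|^alpha) <= 2] for the [u] that
compete in the infimum defining [K] ([mgf_dominated], [mgf_le_dominated]); the
passage to [K] is by continuity of the bound in [u] ([mgf_le_orlicz_norm]). Four such pointwise bounds are used:
a Taylor bound for [|s| <= 1/2], a Gaussian bound for [alpha >= 2], Young's
inequality, and for [alpha > 1] a comparison with the chord of [expR] over
[[-1, 1]]. They give, for [C0 = 16 e],
- [log E exp (l X) <= C0 s^2] for all [l] if [alpha >= 2], and for
  [|s| <= 1/2] if [alpha >= 1];
- [log E exp (l X) <= C0 s^2 + (alpha - 1) (|s| / alpha)^b] for all [l] if
  [1 < alpha <= 2];
- [log E exp (l X) <= (alpha - 1) e^(19 / (alpha - 1)) (|s| / alpha)^b] for all
  [l] if [alpha >= 2].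

The right-hand side of the third bound is the Legendre transform of
[x |-> e^(-19) x^alpha], and it is the point where a universal constant is at
stake: as [alpha] grows the factor [e^(19 / (alpha - 1))] tends to 1, so that a
bound with a constant factor in front of [(alpha - 1) (|s| / alpha)^b] would
not do. With [mu = s / alpha], the right-hand side is at least
[mu (alpha - 1 + 19 + ln mu)]. Young's inequality reaches this when [mu] is
bounded below and the Taylor bound when [s] is small; in between, it is the
chord bound, which for a variable nearly in [[-1, 1]] saves a fixed amount over
the exponent [s] ([mgf_dominated_alpha_ge2]).

Independence turns the bounds for each [X i] into a bound for the sum
([integral_prod_independent], [mgf_sum_le]), and Markov's inequality gives
[2 exp (psi - lambda t)] for the tail ([tail_le_mgf]). To conclude
[2 exp (- C r)] for every real [r] below the maximum (or minimum) of the two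
terms, [lambda] is taken to be a multiple of [r / t]; writing the hypotheses on
[r] as [r * G <= t^2] and [r * N^alpha <= t^alpha] makes the degenerate
denominators a case like any other ([le_expeR_reals], [le_div_ereal]). *)

Set Implicit Arguments.
Unset Strict Implicit.
Unset Printing Implicit Defensive.

Import HBNNSimple.

Local Open Scope classical_set_scope.
Local Open Scope ring_scope.

(** * Pointwise bounds on the exponential *)

Section exp_ineq.
Context {R : realType}.
Implicit Types (s z y theta mu alpha : R).

(** Convexity of [expR] between 0 and [y]. It stands in for Jensen's inequality:
if [expR Y] has mean at most 2, then [expR (theta * Y)] has mean at most
[1 + theta]. *)
Lemma expR_mull_le theta y : 0 <= theta <= 1 ->
  expR (theta * y) <= 1 + theta * (expR y - 1).
Proof.
move=> /andP[t0 t1]; set f := expR (theta * y).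
have f0 : 0 <= f by exact: expR_ge0.
have -> : expR y = f * expR ((1 - theta) * y).
  by rewrite -expRD; congr expR; ring.
have e1 : f * (1 + (1 - theta) * y) <= f * expR ((1 - theta) * y).
  by rewrite ler_wpM2l// expR_ge1Dx.
have e2 : f * (1 - theta * y) <= 1.
  rewrite -[leRHS](@expRxMexpNx_1 R (theta * y)) ler_wpM2l//.
  exact: expR_ge1Dx.
have := ler_wpM2l t0 e1.
have t1' : 0 <= 1 - theta by rewrite subr_ge0.
have := ler_wpM2l t1' e2.
nra.
Qed.

(** A Taylor bound that follows from [expR z - 1 <= z * expR z] alone, at the
price of the factor [1/2] of the quadratic term. *)
Lemma expR_le_quadratic z : expR z <= 1 + z + z ^+ 2 * expR `|z|.
Proof.
have h : expR z - 1 <= z * expR z.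
  have := expR_ge1Dx (- z); have := expR_gt0 z.
  have := @expRxMexpNx_1 R z; nra.
have [z0|z0] := leP 0 z.
  rewrite ger0_norm//; nra.
rewrite ltr0_norm//.
have h1 := expR_ge1Dx z.
have h2 : 1 <= expR (- z) by rewrite -[leLHS]expR0 ler_expR; lra.
have h3 : expR z - 1 - z <= z ^+ 2 by nra.
have : z ^+ 2 <= z ^+ 2 * expR (- z) by rewrite ler_peMr// sqr_ge0.
lra.
Qed.

Lemma le_norm_powR alpha z : 1 <= alpha -> `|z| <= 1 + `|z| `^ alpha.
Proof.
move=> a1; have [z1|z1] := leP `|z| 1.
  by rewrite (le_trans z1)// lerDl powR_ge0.
by rewrite (le_trans (le1r_powR (ltW z1) a1))// lerDr.
Qed.

(** Young's inequality for the factors [y] and 1. *)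
Lemma bernoulli_powR alpha y : 1 < alpha -> 0 <= y ->
  alpha * (y - 1) <= y `^ alpha - 1.
Proof.
move=> a1 y0.
have aa : 0 < alpha - 1 by lra.
have := @conjugate_powR R y 1 alpha (alpha / (alpha - 1)) y0 ler01.
rewrite powR1 mulr1.
have a0 : 0 < alpha by lra.
have b0 : 0 < alpha / (alpha - 1) by rewrite divr_gt0.
have e : alpha^-1 + (alpha / (alpha - 1))^-1 = 1.
  by field; rewrite !gt_eqF.
move=> /(_ a0 b0 e) h.
have := ler_wpM2l (ltW a0) h.
have -> : alpha * (y `^ alpha / alpha + 1 / (alpha / (alpha - 1))) =
  y `^ alpha + alpha - 1 by field; rewrite !gt_eqF.
lra.
Qed.

(** The slope [s] is written as [alpha * theta * m], and Young's inequality is applied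
to [|z|] and [m]. *)
Lemma young_powR alpha s theta z : 1 < alpha -> 0 <= s -> 0 < theta ->
  s * z <= theta * `|z| `^ alpha +
    (alpha - 1) * theta * (s / (alpha * theta)) `^ (alpha / (alpha - 1)).
Proof.
move=> a1 s0 t0.
have aa : 0 < alpha - 1 by lra.
have a0 : 0 < alpha by lra.
have b0 : 0 < alpha / (alpha - 1) by rewrite divr_gt0.
have at0 : 0 < alpha * theta by rewrite mulr_gt0.
set m := s / (alpha * theta).
have m0 : 0 <= m by rewrite divr_ge0// ltW.
have -> : s = alpha * theta * m by rewrite /m; field; rewrite !gt_eqF.
have e : alpha^-1 + (alpha / (alpha - 1))^-1 = 1.
  by field; rewrite !gt_eqF.
have h := @conjugate_powR R `|z| m alpha (alpha / (alpha - 1)) (normr_ge0 _) m0 a0 b0 e.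
have {}h := ler_wpM2l (ltW at0) h.
apply: (@le_trans _ _ (alpha * theta * (`|z| * m))).
  rewrite -mulrA ler_wpM2l ?(ltW at0)// [m * z]mulrC ler_wpM2r//.
  exact: ler_norm.
apply: (le_trans h); rewrite le_eqVlt; apply/orP; left; apply/eqP.
by field; rewrite !gt_eqF.
Qed.

Lemma expR_le_small alpha s z : 1 <= alpha -> `|s| <= 2^-1 ->
  expR (s * z) <=
    1 + s * z + 8 * expR 1 * s ^+ 2 * expR (`|z| `^ alpha).
Proof.
move=> a1 hs; apply: (le_trans (expR_le_quadratic _)).
rewrite lerD2l normrM exprMn.
have h1 : z ^+ 2 <= 8 * expR (2^-1 * `|z|).
  have z0 : 0 <= 2^-1 * `|z| by rewrite mulr_ge0.
  have := expR_ge1Dxn 1 z0.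
  rewrite -(real_normK (num_real z)).
  rewrite (_ : 2`!%:R = 2 :> R)//; nra.
have h2 : expR (`|s| * `|z|) <= expR (2^-1 * `|z|).
  by rewrite ler_expR ler_wpM2r.
have h3 : expR (2^-1 * `|z|) * expR (2^-1 * `|z|) <= expR 1 * expR (`|z| `^ alpha).
  rewrite -!expRD ler_expR -mulrDl (_ : 2^-1 + 2^-1 = 1); last by lra.
  by rewrite mul1r; exact: le_norm_powR.
have := expR_gt0 (2^-1 * `|z|); have := expR_gt0 (`|s| * `|z|).
move=> p1 p2.
have h4 : z ^+ 2 * expR (`|s| * `|z|) <= 8 * (expR 1 * expR (`|z| `^ alpha)).
  apply: (@le_trans _ _ (8 * expR (2^-1 * `|z|) * expR (2^-1 * `|z|))).
    by rewrite ler_pM// ?sqr_ge0 ?expR_ge0.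
  by rewrite -mulrA ler_wpM2l.
have := ler_wpM2l (sqr_ge0 s) h4; lra.
Qed.

Lemma expR_le_young alpha s theta z : 1 < alpha -> 0 <= s -> 0 < theta <= 1 ->
  expR (s * z) <=
    expR ((alpha - 1) * theta * (s / (alpha * theta)) `^ (alpha / (alpha - 1))) *
    (1 + theta * (expR (`|z| `^ alpha) - 1)).
Proof.
move=> a1 s0 /andP[t0 t1].
set E := expR (_ * _ `^ _).
apply: (@le_trans _ _ (E * expR (theta * `|z| `^ alpha))).
  rewrite /E -expRD ler_expR addrC; exact: young_powR.
by rewrite ler_wpM2l ?expR_ge0// expR_mull_le// (ltW t0).
Qed.

Lemma expR_le_chord s z : `|z| <= 1 ->
  expR (s * z) <= (expR s + expR (- s)) / 2 + (expR s - expR (- s)) / 2 * z.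
Proof.
rewrite ler_norml => /andP[z1 z2].
have t01 : 0 <= (1 + z) / 2 <= 1 by lra.
have h := expR_mull_le (2 * s) t01.
have -> : s * z = - s + (1 + z) / 2 * (2 * s) by field.
rewrite expRD.
have h1 := ler_wpM2l (expR_ge0 (- s)) h.
apply: (le_trans h1).
have -> : expR (2 * s) = expR s * expR s by rewrite -expRD; congr expR; ring.
have := @expRxMexpNx_1 R s; set e := expR s; set e' := expR (- s) => ee.
rewrite le_eqVlt; apply/orP; left; apply/eqP.
have -> : e' * (1 + (1 + z) / 2 * (e * e - 1)) = e' + (1 + z) / 2 * ((e * e') * e - e') by ring.
by rewrite ee; field.
Qed.

(** Inside [[-1, 1]] the chord suffices. Outside, Bernoulli's inequality turns the
excess [s * (|z| - 1)] into at most [(s / alpha) * (|z|^alpha - 1)], which is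
paid for by the last term. Hence a centred variable costs little more than a
centred variable with values in [[-1, 1]], whose moment generating function is
at most the hyperbolic cosine. *)
Lemma expR_le_mean0 alpha s z : 1 < alpha -> 0 <= s <= alpha ->
  expR (s * z) <=
    (expR s + expR (- s)) / 2 + (expR s - expR (- s)) / 2 * z +
    expR s * (s / alpha) * (expR (`|z| `^ alpha) - 1).
Proof.
move=> a1 /andP[s0 sa].
have a0 : 0 < alpha by lra.
set mu := s / alpha; set y := `|z| `^ alpha.
have mu01 : 0 <= mu <= 1 by rewrite divr_ge0 ?(ltW a0)//= ler_pdivrMr// mul1r.
have y0 : 0 <= y by exact: powR_ge0.
have c1 := expR_mull_le y mu01.
have smu : s = alpha * mu by rewrite /mu; field; rewrite gt_eqF.
have /andP[mu0 mu1] := mu01.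
have bern : s * (`|z| - 1) <= mu * (y - 1).
  by rewrite smu mulrAC mulrC ler_wpM2l// bernoulli_powR.
have e1 : 1 <= expR y by rewrite -[leLHS]expR0 ler_expR.
have es := expR_gt0 s.
suff : expR (s * z) <= (expR s + expR (- s)) / 2 + (expR s - expR (- s)) / 2 * z +
    expR s * (expR (mu * y) - 1).
  move/le_trans; apply; rewrite lerD2l -mulrA ler_wpM2l ?(ltW es)//; lra.
have em : 1 + mu * y <= expR (mu * y) by exact: expR_ge1Dx.
have my : 0 <= mu * y by rewrite mulr_ge0.
have [z1|z1] := leP `|z| 1.
  apply: (le_trans (expR_le_chord s z1)); rewrite lerDl mulr_ge0 ?(ltW es)//; lra.
have nes : expR (- s) <= expR s by rewrite ler_expR; lra.
have [z0|z0] := leP 0 z.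
  move: z1 bern; rewrite ger0_norm// => z1 bern.
  have : expR (s * z) <= expR s * expR (mu * y).
    rewrite -expRD ler_expR; lra.
  nra.
move: z1 bern; rewrite ltr0_norm// => z1 bern.
have : expR (s * z) <= expR (- s) by rewrite ler_expR; nra.
have h2 : expR s - expR (- s) <= 2 * s * expR s.
  have := expR_ge1Dx (- (2 * s)); have := expR_gt0 (- s).
  have -> : expR (- (2 * s)) = expR (- s) * expR (- s).
    by rewrite -expRD; congr expR; ring.
  have := @expRxMexpNx_1 R s; nra.
have h3 : (- z - 1) * ((expR s - expR (- s)) / 2) <= expR s * (expR (mu * y) - 1).
  apply: (@le_trans _ _ ((- z - 1) * (s * expR s))).
    by rewrite ler_wpM2l; lra.
  rewrite mulrCA mulrA [leRHS]mulrC ler_wpM2r ?(ltW es)//; nra.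
lra.
Qed.

(** Young's inequality [s * z <= s^2 / 2 + z^2 / 2], with
[z^2 <= 1 + |z|^alpha]. *)
Lemma expR_le_square alpha s z : 2 <= alpha ->
  expR (s * z) <=
    expR (s ^+ 2 / 2 + 2^-1) * (2^-1 + 2^-1 * expR (`|z| `^ alpha)).
Proof.
move=> a2.
have zz : z ^+ 2 <= 1 + `|z| `^ alpha.
  rewrite -(real_normK (num_real z)).
  have [z1|z1] := leP `|z| 1.
    by rewrite (le_trans (exprn_ile1 _ (normr_ge0 z) z1))// lerDl powR_ge0.
  rewrite -powR_mulrn//.
  by rewrite (le_trans (ler_powR (ltW z1) a2))// lerDr.
have h01 : 0 <= (2^-1 : R) <= 1 by lra.
have c1 := expR_mull_le (`|z| `^ alpha) h01.
apply: (@le_trans _ _ (expR (s ^+ 2 / 2 + 2^-1) * expR (2^-1 * `|z| `^ alpha))).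
  rewrite -expRD ler_expR; have := sqr_ge0 (s - z); nra.
rewrite ler_wpM2l ?expR_ge0//; lra.
Qed.

End exp_ineq.

(** * Bounds on the moment generating function of a normalized variable *)

Section mgf_dominated.
Context {R : realType}.
Implicit Types (s v z theta mu alpha : R).

(** A certificate that [E expR (s * Z) <= v] for every centred [Z] with
[E expR (|Z|^alpha) <= 2]. Keeping the certificate pointwise confines the case
analysis on [s] and [alpha] to real inequalities. *)
Definition mgf_dominated alpha s v :=
  exists A b B : R, [/\ 0 <= B, A + 2 * B <= v &
    forall z, expR (s * z) <= A + b * z + B * expR (`|z| `^ alpha)].

Lemma mgf_dominatedN alpha s v :
  mgf_dominated alpha s v -> mgf_dominated alpha (- s) v.
Proof.
move=> [A [b [B [B0 v0 h]]]]; exists A, (- b), B; split => // z.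
by have := h (- z); rewrite normrN mulrN mulNr mulrN mulNr.
Qed.

Lemma mgf_dominated_le alpha s v v' : v <= v' ->
  mgf_dominated alpha s v -> mgf_dominated alpha s v'.
Proof.
move=> vv [A [b [B [B0 v0 h]]]]; exists A, b, B; split => //.
exact: le_trans vv.
Qed.

Lemma mgf_dominated_norm alpha s v :
  mgf_dominated alpha `|s| v -> mgf_dominated alpha s v.
Proof.
have [s0|s0] := leP 0 s; first by rewrite ger0_norm.
by rewrite ltr0_norm// => /mgf_dominatedN; rewrite opprK.
Qed.

Lemma mgf_dominated_small alpha s : 1 <= alpha -> `|s| <= 2^-1 ->
  mgf_dominated alpha s (expR (16 * expR 1 * s ^+ 2)).
Proof.
move=> a1 hs; exists 1, s, (8 * expR 1 * s ^+ 2); split.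
- by rewrite mulr_ge0 ?sqr_ge0// mulr_ge0 ?expR_ge0.
- by rewrite (le_trans _ (expR_ge1Dx _))// lerD2l; lra.
- by move=> z; exact: expR_le_small.
Qed.

Lemma mgf_dominated_young alpha s theta :
  1 < alpha -> 0 <= s -> 0 < theta <= 1 ->
  mgf_dominated alpha s (expR (theta + (alpha - 1) * theta *
    (s / (alpha * theta)) `^ (alpha / (alpha - 1)))).
Proof.
move=> a1 s0 /andP[t0 t1].
set E := (alpha - 1) * theta * _.
exists (expR E * (1 - theta)), 0, (expR E * theta); split.
- by rewrite mulr_ge0 ?expR_ge0 ?ltW.
- rewrite addrC expRD -[leLHS](_ : (1 + theta) * expR E = _); last by ring.
  by rewrite addrC ler_wpM2r ?expR_ge0// addrC expR_ge1Dx.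
- move=> z; have t01 : 0 < theta <= 1 by rewrite t0.
  apply: (le_trans (expR_le_young z a1 s0 t01)).
  by rewrite -/E le_eqVlt; apply/orP; left; apply/eqP; ring.
Qed.

Lemma mgf_dominated_mean0 alpha s : 1 < alpha -> 0 <= s <= alpha ->
  mgf_dominated alpha s
    ((expR s + expR (- s)) / 2 + expR s * (s / alpha)).
Proof.
move=> a1 /andP[s0 sa].
exists ((expR s + expR (- s)) / 2 - expR s * (s / alpha)),
  ((expR s - expR (- s)) / 2), (expR s * (s / alpha)); split.
- by rewrite mulr_ge0 ?expR_ge0 ?divr_ge0//; lra.
- lra.
- move=> z; have sa' : 0 <= s <= alpha by rewrite s0.
  apply: (le_trans (expR_le_mean0 z a1 sa')); lra.
Qed.

Lemma expR1_ge2 : 2 <= expR 1 :> R.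
Proof. by have := @expR_ge1Dx R 1; lra. Qed.

Lemma exp2_le_expR n : 2 ^+ n <= expR n%:R :> R.
Proof.
rewrite -[n%:R]mulr1 expRM_natl.
by rewrite lerXn2r ?nnegrE ?expR_ge0 ?expR1_ge2.
Qed.

(** For [|s| >= 1/2] the additive constants of the square bound are absorbed by
[s^2 >= 1/4]. *)
Lemma mgf_dominated_gaussian alpha s : 2 <= alpha ->
  mgf_dominated alpha s (expR (16 * expR 1 * s ^+ 2)).
Proof.
move=> a2; have [hs|hs] := leP `|s| 2^-1.
  by apply: mgf_dominated_small => //; lra.
exists (expR (s ^+ 2 / 2 + 2^-1) * 2^-1), 0,
  (expR (s ^+ 2 / 2 + 2^-1) * 2^-1); split.
- by rewrite mulr_ge0 ?expR_ge0.
- apply: (@le_trans _ _ (expR (s ^+ 2 / 2 + 2^-1) * expR 2^-1)).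
    have := @expR_ge1Dx R 2^-1; have := expR_ge0 (s ^+ 2 / 2 + 2^-1); nra.
  rewrite -expRD ler_expR.
  have : 4^-1 <= s ^+ 2.
    rewrite -(real_normK (num_real s)); nra.
  have := expR1_ge2; nra.
- move=> z; apply: (le_trans (expR_le_square s z a2)); lra.
Qed.

(** For [|s| >= 1/2] Young's inequality leaves an additive 1, which the Gaussian
term absorbs. *)
Lemma mgf_dominated_alpha_le2 alpha s : 1 < alpha <= 2 ->
  mgf_dominated alpha s (expR (16 * expR 1 * s ^+ 2 +
    (alpha - 1) * (`|s| / alpha) `^ (alpha / (alpha - 1)))).
Proof.
move=> /andP[a1 a2]; have [hs|hs] := leP `|s| 2^-1.
  have := mgf_dominated_small (ltW a1) hs.
  apply: mgf_dominated_le.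
  by rewrite ler_expR lerDl mulr_ge0 ?powR_ge0//; lra.
apply: mgf_dominated_norm.
have h01 : 0 < (1 : R) <= 1 by rewrite ltr01 lexx.
have := mgf_dominated_young a1 (normr_ge0 s) h01.
rewrite !mulr1; apply: mgf_dominated_le.
rewrite ler_expR lerD2r.
have : 4^-1 <= s ^+ 2.
  rewrite -(real_normK (num_real s)); nra.
have := expR1_ge2; nra.
Qed.

Lemma powR_conj alpha mu : 1 < alpha -> 0 < mu ->
  mu `^ (alpha / (alpha - 1)) = mu * expR (ln mu / (alpha - 1)).
Proof.
move=> a1 m0; rewrite /powR gt_eqF// -{2}(lnK m0) -expRD; congr expR.
by field; rewrite subr_eq0 gt_eqF.
Qed.

(** From [- ln sqrt x <= 1 / sqrt x]. *)
Lemma oppr_mul_ln_le (x : R) (n : R) : 0 < x <= expR (- n) ->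
  - (x * ln x) <= 2 * expR (- (n / 2)).
Proof.
move=> /andP[x0 xn]; set r := expR (ln x / 2).
have xr : x = r * r by rewrite -expRD -splitr lnK.
have r0 : 0 < r by exact: expR_gt0.
have h1 : - (ln x / 2) <= expR (- (ln x / 2)).
  by have := expR_ge1Dx (- (ln x / 2)); lra.
have h2 : r * expR (- (ln x / 2)) = 1 by exact: expRxMexpNx_1.
have h3 : - (x * ln x) <= 2 * r.
  have := ler_wpM2l (ltW r0) h1; rewrite h2 => h4.
  have := ler_wpM2l (ltW r0) h4.
  have -> : x * ln x = r * r * ln x by rewrite -xr.
  rewrite mulr1; lra.
apply: (le_trans h3); rewrite ler_wpM2l// ler_expR.
by have := xn; rewrite -{1}(lnK x0) ler_expR; lra.
Qed.

Lemma sub_expRN_ge (x : R) : 0 <= x <= 2^-1 -> x <= 1 - expR (- (2 * x)).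
Proof.
move=> /andP[x0 x1].
have := expR_ge1Dx (2 * x); have := expR_gt0 (- (2 * x)).
have := @expRxMexpNx_1 R (2 * x); nra.
Qed.

(** With [mu = s / alpha], the exponent is [a mu e^((19 + ln mu) / a)] for
[a = alpha - 1], hence at least [mu (a + 19 + ln mu)]. Four ranges:
- [mu >= 1]: Young's inequality with [theta = 1], the excess 1 being covered
  by [e^(19 / a) >= 1 + 19 / a];
- [e^(-18) <= mu < 1]: Young's inequality with [theta = mu], which yields the
  exponent [mu + a mu];
- [s <= e^(-7)]: the Taylor bound; after taking logarithms, the claim reduces
  to [a (6 + ln s) <= 19 + ln s - ln alpha], which follows from [a >= 1],
  [ln s <= -7] and [ln alpha <= a];
- the remaining range: the chord bound, whose gain [(1 - e^(-2 s)) / 2] over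
  [e^s] exceeds the loss [- mu ln mu <= 2 e^(-9)]. This comparison
  sets the threshold [e^(-18)], and the second range then asks for
  [19 = 18 + 1]. *)
Lemma mgf_dominated_alpha_ge2 alpha s : 2 <= alpha ->
  mgf_dominated alpha s (expR ((alpha - 1) * expR (19 / (alpha - 1)) *
    (`|s| / alpha) `^ (alpha / (alpha - 1)))).
Proof.
move=> a2; apply: mgf_dominated_norm; have := normr_ge0 s; move: (`|s| : R) => {}s.
have a1 : 1 < alpha by lra.
have a0 : 0 < alpha by lra.
rewrite le_eqVlt => /predU1P[<-|s0].
  rewrite mul0r powR0; last by rewrite gt_eqF// divr_gt0//; lra.
  have h0 : `|0 : R| <= 2^-1 by rewrite normr0; lra.
  by have := mgf_dominated_small (ltW a1) h0; rewrite expr0n/= !mulr0.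
set a := alpha - 1; have age1 : 1 <= a by rewrite /a; lra.
set mu := s / alpha; have mu0 : 0 < mu by rewrite divr_gt0.
have smu : s = alpha * mu by rewrite /mu; field; rewrite gt_eqF.
have alE : alpha = a + 1 by rewrite /a; lra.
have m1 : mu `^ (alpha / a) = mu * expR (ln mu / a) by exact: powR_conj.
have psiE : a * expR (19 / a) * mu `^ (alpha / a) =
    a * mu * expR ((19 + ln mu) / a).
  by rewrite m1 [(19 + _) / a]mulrDl expRD; ring.
have psi_ge : mu * (a + 19 + ln mu) <= a * expR (19 / a) * mu `^ (alpha / a).
  rewrite psiE; have := expR_ge1Dx ((19 + ln mu) / a).
  have am : 0 <= a * mu by rewrite mulr_ge0//; lra.
  move=> /(ler_wpM2l am); apply: le_trans; rewrite le_eqVlt; apply/orP; left.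
  by apply/eqP; field; rewrite gt_eqF//; lra.
have [mu1|mu1] := leP 1 mu.
  have h01 : 0 < (1 : R) <= 1 by rewrite ltr01 lexx.
  have := mgf_dominated_young a1 (ltW s0) h01.
  rewrite !mulr1; apply: mgf_dominated_le; rewrite ler_expR -/a -/mu.
  have h1 : 1 <= mu `^ (alpha / a).
    by rewrite -[leLHS](congr1 (@^~ (alpha / a)) (powR1 R)) ge0_ler_powR ?nnegrE ?divr_ge0//; lra.
  have h2 : a + 19 <= a * expR (19 / a).
    have age0 : 0 <= a by lra.
    have := ler_wpM2l age0 (expR_ge1Dx (19 / a)); apply: le_trans.
    by rewrite le_eqVlt; apply/orP; left; apply/eqP; field; rewrite gt_eqF//; lra.
  nra.
have [mu2|mu2] := leP (expR (- 18)) mu.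
  have h01 : 0 < mu <= 1 by rewrite mu0 ltW.
  have := mgf_dominated_young a1 (ltW s0) h01.
  rewrite -smu divff ?gt_eqF// powR1 mulr1; apply: mgf_dominated_le.
  rewrite ler_expR; apply: le_trans psi_ge.
  have : - 18 <= ln mu by rewrite -ler_expR lnK.
  rewrite -/a; nra.
(* [32 e s <= e^(6 + ln s)] because [32 <= e^5]. *)
have [s7|s7] := leP s (expR (- 7)).
  have s12 : `|s| <= 2^-1.
    rewrite gtr0_norm// (le_trans s7)// expRN lef_pV2 ?posrE ?expR_gt0//.
    by rewrite (le_trans expR1_ge2)// ler_expR; lra.
  have := mgf_dominated_small (ltW a1) s12; apply: mgf_dominated_le.
  rewrite ler_expR psiE -/a.
  have lns : ln s = ln alpha + ln mu by rewrite smu lnM.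
  have lna : ln alpha <= a by rewrite alE addrC le_ln1Dx//; lra.
  have ls7 : ln s <= - 7 by rewrite -ler_expR lnK.
  have h1 : 32 * expR 1 * s <= expR ((19 + ln mu) / a).
    apply: (@le_trans _ _ (expR (6 + ln s))).
      rewrite expRD lnK// ler_wpM2r ?(ltW s0)//.
      rewrite (_ : 6 = 5%:R + 1)%R; last by lra.
      rewrite expRD ler_wpM2r ?expR_ge0//.
      by apply: le_trans (exp2_le_expR 5); lra.
    rewrite ler_expR ler_pdivlMr; last by lra.
    nra.
  rewrite expr2 mulrA {2}smu.
  have -> : 16 * expR 1 * s * (alpha * mu) = (32 * expR 1 * s) * (alpha * mu / 2) by field.
  rewrite [leRHS]mulrC ler_pM//.
  - by rewrite !mulr_ge0 ?expR_ge0// ltW.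
  - by rewrite divr_ge0// mulr_ge0// ltW.
  - nra.
have sal : 0 <= s <= alpha.
  by rewrite ltW//= smu -[leRHS]mulr1 ler_wpM2l// ltW.
have := mgf_dominated_mean0 a1 sal; apply: mgf_dominated_le.
apply: (@le_trans _ _ (expR s * (1 + mu * (18 + ln mu)))); last first.
  apply: (@le_trans _ _ (expR s * expR (mu * (18 + ln mu)))).
    by rewrite ler_wpM2l ?expR_ge0// expR_ge1Dx.
  rewrite -expRD ler_expR; apply: le_trans psi_ge.
  by rewrite {1}smu alE le_eqVlt; apply/orP; left; apply/eqP; ring.
have -> : expR (- s) = expR s * expR (- (2 * s)) by rewrite -expRD; congr expR; ring.
rewrite -/mu.
suff h : (1 + expR (- (2 * s))) / 2 + mu <= 1 + mu * (18 + ln mu).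
  by have := ler_wpM2l (expR_ge0 s) h; lra.
have hm : 0 < mu <= expR (- 18) by rewrite mu0 ltW.
have := oppr_mul_ln_le hm; rewrite (_ : 18 / 2 = 2%:R + 7)%R; last by lra.
rewrite opprD expRD.
have e7 := @expR_gt0 R (- 7).
have h2 : expR (- 2%:R) <= 4^-1 :> R.
  rewrite expRN lef_pV2 ?posrE ?expR_gt0//.
  by apply: le_trans (exp2_le_expR 2); lra.
have h3 : expR (- 7) <= 1 - expR (- (2 * s)).
  have x01 : 0 <= (expR (- 7) : R) <= 2^-1.
    rewrite ltW//= expRN lef_pV2 ?posrE ?expR_gt0//.
    by rewrite (le_trans expR1_ge2)// ler_expR; lra.
  apply: (le_trans (sub_expRN_ge x01)).
  by rewrite lerD2l lerN2 ler_expR; lra.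
nra.
Qed.

End mgf_dominated.

Local Open Scope ereal_scope.

(** * Expectation of a product of functions of independent variables *)

Section product_rule.
Context d (T : measurableType d) (R : realType) (P : probability T R).

(** The absolute value keeps all summands nonnegative, also those indexed outside
the range of [f]. *)
Lemma integral_comp_mul_simple (X h : T -> R) (f : {nnsfun R >-> R}) :
  measurable_fun setT X -> measurable_fun setT h -> (forall w, 0 <= h w)%R ->
  \int[P]_w (f (X w) * h w)%:E =
  \sum_(y \in range f)
    `|y|%:E * \int[P]_w (\1_(f @^-1` [set y]) (X w) * h w)%:E.
Proof.
move=> mX mh h0.
have ff : finite_set (range f) by exact: fimfunP.
have mi y : measurable_fun setT
    ((\1_(f @^-1` [set y]) \o X) \* h)%R.
  apply: measurable_funM => //.
  by apply: measurableT_comp => //; exact: measurable_indic.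
have i0 y w : 0 <= (\1_(f @^-1` [set y]) (X w) * h w)%:E.
  by rewrite lee_fin mulr_ge0.
under eq_fsbigr do (rewrite -ge0_integralZl//; last by apply/measurable_EFinP; exact: mi).
rewrite -ge0_integral_fsum//; last 2 first.
- by move=> y; apply: measurable_funeM; apply/measurable_EFinP; exact: mi.
- by move=> y w _; rewrite mule_ge0.
apply: eq_integral => w _; rewrite fimfunE !fsbig_finite//= mulr_suml -sumEFin.
rewrite !big_seq; apply: eq_bigr => y.
rewrite in_fset_set// inE => -[x _ <-].
by rewrite -EFinM mulrA ger0_norm.
Qed.

(** Extends an identity from indicators to nonnegative measurable functions by
monotone convergence along simple functions. Used with [h2] constant, it says
that independence of [h1] from the events of [X] implies that the expectation
of [f (X) * h1] factors. *)
Lemma integral_comp_mul_eq (X h1 h2 : T -> R) :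
  measurable_fun setT X -> measurable_fun setT h1 -> measurable_fun setT h2 ->
  (forall w, 0 <= h1 w)%R -> (forall w, 0 <= h2 w)%R ->
  (forall B, measurable B ->
    \int[P]_w (\1_B (X w) * h1 w)%:E = \int[P]_w (\1_B (X w) * h2 w)%:E) ->
  forall f : R -> R, measurable_fun setT f -> (forall x, 0 <= f x)%R ->
    \int[P]_w (f (X w) * h1 w)%:E = \int[P]_w (f (X w) * h2 w)%:E.
Proof.
move=> mX mh1 mh2 h10 h20 hB f mf f0.
have mfE : measurable_fun setT (EFin \o f) by exact/measurable_EFinP.
have fE0 x : setT x -> 0 <= (EFin \o f) x by rewrite lee_fin.
have [g [ndg gf]] := approximation measurableT mfE fE0.
have lim (h : T -> R) : measurable_fun setT h -> (forall w, 0 <= h w)%R ->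
    \int[P]_w (g n (X w) * h w)%:E @[n --> \oo] -->
    \int[P]_w (f (X w) * h w)%:E.
  move=> mh h0.
  have := @cvg_monotone_convergence _ _ _ P setT measurableT
    (fun n w => (g n (X w) * h w)%:E).
  under eq_integral => w _.
    rewrite (_ : limn _ = (f (X w) * h w)%:E); last first.
      apply/cvg_lim => //; under eq_fun do rewrite EFinM.
      by rewrite EFinM; apply: cvgeZr => //; exact: gf.
    over.
  apply.
  - move=> n; apply/measurable_EFinP; apply: measurable_funM => //.
    exact: measurableT_comp.
  - by move=> n w _; rewrite lee_fin mulr_ge0.
  - move=> w _ m n mn; rewrite lee_fin ler_wpM2r//.
    exact/lefP/ndg.
have e n : \int[P]_w (g n (X w) * h2 w)%:E = \int[P]_w (g n (X w) * h1 w)%:E.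
  rewrite !integral_comp_mul_simple//.
  by apply: eq_fsbigr => y _; rewrite hB.
have := lim _ mh2 h20; under eq_fun do rewrite e.
move=> h; apply: cvg_unique h => //; exact: lim.
Qed.


Lemma integral_prod_indic (I : finType) (X : I -> {RV P >-> R})
    (B : I -> set R) :
  independent_RVs X -> (forall i, measurable (B i)) ->
  \int[P]_w (\prod_i (\1_(B i) (X i w) : R))%:E =
  \prod_i \int[P]_w (\1_(B i) (X i w))%:E.
Proof.
move=> iX mB.
have mXB i : measurable (X i @^-1` B i).
  by rewrite -[_ @^-1` _]setTI; exact: measurable_funPT.
under [RHS]eq_bigr => i _.
  rewrite (eq_integral (EFin \o \1_(X i @^-1` B i))); last by move=> w _; rewrite /= !indicE.
  rewrite integral_indic// setIT.
over.
rewrite (eq_bigl (fun i => i \in [set: I]%SET)); last first.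
  by move=> i; rewrite finset.in_setT.
rewrite -iX// -[X in P X]setIT -integral_indic//; last first.
  by apply: fin_bigcap_measurable => //; exact: finite_finset.
apply: eq_integral => w _; congr EFin; rewrite indicE.
case: (boolP (_ \in _)); rewrite ?inE/= => h.
  rewrite big1// => i _; rewrite indicE mem_set//.
  by apply: h => /=; rewrite inE.
apply/eqP; rewrite prodf_seq_eq0.
have : exists i, X i w \notin B i.
  apply/existsP; apply: contraT; rewrite negb_exists => /forallP hn.
  move/negP: h; rewrite inE => h; exfalso; apply: h => i _ /=.
  by have := hn i; rewrite negbK inE.
move=> [i hi]; apply/hasP; exists i; first by rewrite mem_index_enum.
by rewrite indicE (negbTE hi) /= eqxx.
Qed.

(** Starting from indicators, where this is the definition of independence, the
indicators are replaced by the [f i] one index at a time. Induction is on the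
number [k] of indices already replaced; no generated sigma-algebra has to be
shown independent of another. *)
Lemma integral_prod_independent n (X : 'I_n -> {RV P >-> R})
    (f : 'I_n -> R -> R) :
  independent_RVs X -> (forall i, measurable_fun setT (f i)) ->
  (forall i x, 0 <= f i x)%R ->
  (forall i, \int[P]_w (f i (X i w))%:E < +oo) ->
  \int[P]_w (\prod_i f i (X i w))%:E = \prod_i \int[P]_w (f i (X i w))%:E.
Proof.
move=> iX.
suff : forall k (f : 'I_n -> R -> R),
  (forall i : 'I_n, (k <= i)%N -> exists2 B, measurable B & f i = \1_B) ->
  (forall i, measurable_fun setT (f i)) ->
  (forall i x, 0 <= f i x)%R ->
  (forall i, \int[P]_w (f i (X i w))%:E < +oo) ->
  \int[P]_w (\prod_i f i (X i w))%:E = \prod_i \int[P]_w (f i (X i w))%:E.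
  by move=> /(_ n f); apply => i; rewrite leqNgt ltn_ord.
elim=> [{}f fB _ _ _|k IH {}f fB mf f0 foo].
  have /choice[B hB] : forall i, exists B, measurable B /\ f i = \1_B.
    by move=> i; have [B mB fi] := fB i isT; exists B.
  under eq_integral do under eq_bigr => i _ do rewrite (proj2 (hB i)).
  under eq_bigr => i _ do rewrite (proj2 (hB i)).
  by apply: integral_prod_indic => // i; case: (hB i).
have [nk|kn] := leqP n k.
  apply: IH => // i ki; exfalso.
  by have := leq_trans (ltn_ord i) (leq_trans nk ki); rewrite ltnn.
pose i0 := Ordinal kn.
have mfX i : measurable_fun setT (f i \o X i) by exact: measurableT_comp.
have F0 i : 0 <= \int[P]_w (f i (X i w))%:E.
  by apply: integral_ge0 => w _; rewrite lee_fin.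
pose h1 w := (\prod_(i | i != i0) f i (X i w))%R.
pose c := \prod_(i | i != i0) \int[P]_w (f i (X i w))%:E.
have c0 : 0 <= c by rewrite /c; elim/big_ind: _ => // x y; exact: mule_ge0.
have cfin : c \is a fin_num.
  rewrite /c; elim/big_ind: _ => //.
  - by move=> x y; exact: fin_numM.
  - by move=> i _; rewrite ge0_fin_numE.
have mh1 : measurable_fun setT h1.
  rewrite /h1; under eq_fun do rewrite -big_filter.
  by apply: measurable_prod => i _; exact: mfX.
have h10 w : (0 <= h1 w)%R by apply: prodr_ge0.
(* With the indicator of [B] at [i0], the induction hypothesis applies. *)
have eqB B : measurable B ->
    \int[P]_w (\1_B (X i0 w) * h1 w)%:E =
    \int[P]_w (\1_B (X i0 w) * cst (fine c) w)%:E.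
  move=> mB; pose g i : R -> R := if i == i0 then \1_B else f i.
  have gi0 : g i0 = \1_B by rewrite /g eqxx.
  have gi i : i != i0 -> g i = f i by rewrite /g => /negbTE ->.
  have mX0 : measurable_fun setT ((\1_B : R -> R) \o X i0).
    by apply: measurableT_comp => //; exact: measurable_indic.
  have := IH g; rewrite (bigD1 i0)//= gi0.
  rewrite [X in _ * X](_ : _ = c); last first.
    by apply: eq_bigr => i ii; rewrite gi.
  under eq_integral.
    move=> w _; rewrite (bigD1 i0)//= gi0.
    rewrite [X in (_ * X)%R](_ : _ = h1 w); last first.
      by apply: eq_bigr => i ii; rewrite gi.
    over.
  move=> -> //.
  - under [RHS]eq_integral do rewrite EFinM.
    rewrite ge0_integralZr//= ?fineK ?fine_ge0//; first exact/measurable_EFinP.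
  - move=> i ki; have [->|ii] := eqVneq i i0; first by exists B.
    rewrite gi//; apply: fB; rewrite ltn_neqAle ki andbT.
    by apply: contra ii => /eqP ki'; apply/eqP/val_inj.
  - move=> i; have [->|ii] := eqVneq i i0; last by rewrite gi.
    by rewrite gi0; exact: measurable_indic.
  - move=> i x; have [->|ii] := eqVneq i i0; last by rewrite gi.
    by rewrite gi0.
  - move=> i; have [->|ii] := eqVneq i i0; last by rewrite gi.
    rewrite gi0 (@le_lt_trans _ _ 1) ?ltry//.
    apply: (@le_trans _ _ (\int[P]_w (cst 1) w)); last first.
      by rewrite integral_cst// mul1e; exact: probability_le1.
    apply: ge0_le_integral => //.
    + exact/measurable_EFinP.
    + by move=> w _; rewrite lee_fin indicE; case: (_ \in _).
rewrite [RHS](bigD1 i0)//= -/c.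
under eq_integral do rewrite (bigD1 i0)//= -/(h1 _).
have fc0 : (0 <= fine c)%R by exact: fine_ge0.
rewrite (integral_comp_mul_eq (h2 := cst (fine c)) _ _ _ _ _ eqB)//.
under eq_integral do rewrite EFinM /=.
rewrite ge0_integralZr//= ?fineK//; first by apply/measurable_EFinP; exact: mfX.
by move=> w _; rewrite lee_fin.
Qed.

End product_rule.

(** * From pointwise bounds to the Orlicz norm *)

Section mgf_bounds.
Context d (T : measurableType d) (R : realType) (P : probability T R).

(** The certificate is integrated at [z = X / u]. *)
Lemma mgf_le_dominated (X : {RV P >-> R}) (alpha u l v : R) :
  'E_P[X] = 0 -> (1 <= alpha)%R -> (0 < u)%R ->
  'E_P[fun w => expR ((`|X w| / u) `^ alpha)%R] <= 2%:E ->
  mgf_dominated alpha (l * u) v ->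
  'E_P[fun w => expR (l * X w)%R] <= v%:E.
Proof.
rewrite !unlock => X0 a1 u0 EX [A [b [B [B0 ABv h]]]].
pose F w := (expR ((`|X w| / u) `^ alpha))%R.
have mX : measurable_fun setT (X : T -> R) by [].
have mF : measurable_fun setT F.
  apply: measurableT_comp => //.
  apply: (measurableT_comp (measurable_powR alpha)).
  by apply: measurable_funM => //; exact: measurableT_comp.
have F1 w : (1 <= F w)%R by rewrite -[leLHS]expR0 ler_expR powR_ge0.
have iF : P.-integrable setT (EFin \o F).
  apply/integrableP; split; first exact/measurable_EFinP.
  under eq_integral => w _ do rewrite /= ger0_norm ?expR_ge0//.
  by rewrite (le_lt_trans EX)// ltry.
have Xu w : (`|X w| <= u * F w)%R.
  rewrite mulrC -ler_pdivrMr//.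
  have := le_norm_powR (X w / u) a1.
  rewrite normrM normfV (gtr0_norm u0) => h1.
  by apply: (le_trans h1); exact: expR_ge1Dx.
have iX : P.-integrable setT (EFin \o X).
  apply: (@le_integrable _ _ _ _ _ _ _ (fun w => u%:E * (EFin \o F) w)) => //.
  - exact/measurable_EFinP.
  - move=> w _; rewrite /= lee_fin.
    by rewrite [leRHS]ger0_norm// mulr_ge0 ?expR_ge0// ltW.
  - exact: integrableZl.
pose G w : \bar R := A%:E + (b / u)%:E * (X w)%:E + B%:E * (F w)%:E.
have iA : P.-integrable setT (fun=> A%:E) by exact: finite_measure_integrable_cst.
have ibX : P.-integrable setT (fun w => (b / u)%:E * (X w)%:E) by exact: integrableZl.
have iBF : P.-integrable setT (fun w => B%:E * (F w)%:E) by exact: integrableZl.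
have iAX : P.-integrable setT (fun w => A%:E + (b / u)%:E * (X w)%:E) by exact: integrableD.
have iG : P.-integrable setT G by exact: integrableD.
have leG w : (expR (l * X w))%:E <= G w.
  rewrite /G -!EFinM -!EFinD lee_fin.
  have := h (X w / u)%R; rewrite normrM normfV (gtr0_norm u0).
  have -> : (l * u * (X w / u) = l * X w)%R by field; rewrite gt_eqF.
  by have -> : (b * (X w / u) = b / u * X w)%R by field; rewrite gt_eqF.
have IG : \int[P]_w G w = A%:E + B%:E * \int[P]_w (F w)%:E.
  rewrite integralD// integralD// integralZl// X0 mule0 adde0 integralZl//.
  rewrite integral_cst//; congr (_ + _).
  by rewrite [X in _ * X](_ : _ = 1) ?mule1//; exact: probability_setT.
apply: (@le_trans _ _ (\int[P]_w G w)).
  apply: ge0_le_integral => //.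
  - apply/measurable_EFinP; apply: measurableT_comp => //.
    exact: measurable_funM.
  - exact: (measurable_int P).
rewrite IG; apply: (@le_trans _ _ (A + 2 * B)%:E); last by rewrite lee_fin.
by rewrite EFinD leeD2l// mulrC EFinM lee_wpmul2l.
Qed.

Lemma orlicz_norm_ge0 (X : T -> R) (alpha : R) : 0 <= orlicz_norm P alpha X.
Proof. by apply/ereal_infP => _ [u [u0 _] <-]; rewrite lee_fin ltW. Qed.

(** The norm itself is not an admissible [u] when it is 0; the bound is therefore
taken at admissible [u] that tend to the norm. *)
Lemma orlicz_norm_limit (X : T -> R) (alpha : R) (x : \bar R) (g : R -> R) :
  orlicz_norm P alpha X < +oo ->
  let K := fine (orlicz_norm P alpha X) in
  {for K, continuous g} ->
  (\forall u \near K, (0 < u)%R ->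
    'E_P[fun w => expR ((`|X w| / u) `^ alpha)%R] <= 2%:E -> x <= (g u)%:E) ->
  x <= (g K)%:E.
Proof.
move=> oo K gK near_x.
have ofin : orlicz_norm P alpha X \is a fin_num.
  by rewrite ge0_fin_numE// orlicz_norm_ge0.
have KE : orlicz_norm P alpha X = K%:E by rewrite /K fineK.
apply/lee_addgt0Pr => e e0.
have : \forall u \near K, (0 < u)%R ->
    'E_P[fun w => expR ((`|X w| / u) `^ alpha)%R] <= 2%:E -> x <= (g K)%:E + e%:E.
  have ge : \forall u \near K, (g u < g K + e)%R.
    by have /cvgr_lt := gK; apply; rewrite ltrDl.
  near=> u => u0 uE; apply: (@le_trans _ _ (g u)%:E).
    by move: u0 uE; near: u.
  by rewrite -EFinD lee_fin ltW//; near: u.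
move=> /nbhs_ballP[dl /= dl0 hd].
have [_ [u [u0 uE] <-]] := lb_ereal_inf_adherent dl0 ofin.
rewrite -/(orlicz_norm _ _ _) KE -EFinD lte_fin => udl.
apply: (hd u) => //.
have Ku : (K <= u)%R.
  by rewrite -lee_fin -KE; apply: ereal_inf_lbound; exists u.
by rewrite /ball/= distrC ger0_norm ?subr_ge0// ltrBlDl.
Unshelve. all: by end_near. Qed.

Lemma mgf_le_orlicz_norm (X : {RV P >-> R}) (alpha l : R) (g : R -> R) :
  'E_P[X] = 0 -> (1 <= alpha)%R -> orlicz_norm P alpha X < +oo ->
  let K := fine (orlicz_norm P alpha X) in
  {for K, continuous g} ->
  (\forall u \near K, (0 < u)%R -> mgf_dominated alpha (l * u) (g u)) ->
  'E_P[fun w => expR (l * X w)%R] <= (g K)%:E.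
Proof.
move=> X0 a1 oo K gK near_g; apply: orlicz_norm_limit => //.
by apply: filterS near_g => u hu u0 uE; apply: mgf_le_dominated uE (hu u0).
Qed.

End mgf_bounds.

Section continuity.
Context {R : realType}.

(** The absolute value provides two-sided continuity at 0. *)
Lemma continuous_norm_powR (b : R) : (0 < b)%R ->
  continuous (fun u : R => `|u| `^ b)%R.
Proof.
move=> b0 x; have [->|x0] := eqVneq x 0%R.
  apply/cvgrPdist_lt => e e0; rewrite normr0 powR0 ?gt_eqF//.
  have e1 : (0 < e `^ b^-1)%R by exact: powR_gt0.
  near=> u; rewrite sub0r normrN ger0_norm ?powR_ge0//.
  rewrite -[ltRHS]powRr1 ?ltW// -(mulVf (lt0r_neq0 b0)) powRrM.
  rewrite gt0_ltr_powR ?nnegrE ?powR_ge0//.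
have nx : (0 < `|x|)%R by rewrite normr_gt0.
rewrite /continuous_at.
have -> : (`|x| `^ b = expR (b * ln `|x|))%R by rewrite /powR gt_eqF.
have h : expR (b * ln `|u|)%R @[u --> x] --> expR (b * ln `|x|)%R.
  have lnx : ln `|u|%R @[u --> x] --> ln `|x|%R.
    apply: (@cvg_comp _ _ _ (fun u : R => `|u|%R) (@ln R) _ (nbhs `|x|%R)).
      exact: norm_continuous.
    exact: continuous_ln.
  apply: (@cvg_comp _ _ _ (fun u : R => b * ln `|u|)%R (@expR R) _
    (nbhs (b * ln `|x|)%R)); last exact: continuous_expR.
  by apply: cvgM => //; exact: cvg_cst.
apply: cvg_trans h; apply: near_eq_cvg; near=> u.
rewrite /powR gt_eqF// normr_gt0.
near: u; exact: (cvgr_neq0 _ cvg_id x0).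
Unshelve. all: by end_near. Qed.

End continuity.

Section mgf_orlicz.
Context d (T : measurableType d) (R : realType) (P : probability T R).
Variables (X : {RV P >-> R}) (alpha l : R).
Hypotheses (X0 : 'E_P[X] = 0) (Xoo : orlicz_norm P alpha X < +oo).
Let K := fine (orlicz_norm P alpha X).

Let continuous_mull : continuous (fun u : R => l * u)%R.
Proof. by move=> u; apply: cvgM; [exact: cvg_cst|exact: cvg_id]. Qed.

Let continuous_gauss :
  continuous (fun u : R => 16 * expR 1 * (l * u) ^+ 2)%R.
Proof.
move=> u; apply: cvgM; first exact: cvg_cst.
apply: (@cvg_comp _ _ _ (fun u : R => l * u)%R (fun x : R => x ^+ 2)%R _
  (nbhs (l * u)%R)); first exact: continuous_mull.
exact: exprn_continuous.
Qed.

Let continuous_conj (b c : R) : (0 < b)%R -> (0 < alpha)%R ->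
  continuous (fun u : R => c * (`|l * u| / alpha) `^ b)%R.
Proof.
move=> b0 a0 u; apply: cvgM; first exact: cvg_cst.
have e (v : R) : (`|l * v| / alpha = `|alpha^-1 * (l * v)|)%R.
  by rewrite [RHS]normrM mulrC (ger0_norm (_ : (0 <= alpha^-1)%R)) ?invr_ge0 ?ltW.
under eq_fun do rewrite e; rewrite e.
apply: (@cvg_comp _ _ _ (fun v : R => alpha^-1 * (l * v))%R
  (fun x : R => `|x| `^ b)%R _ (nbhs (alpha^-1 * (l * u))%R)).
  by apply: cvgM; [exact: cvg_cst|exact: continuous_mull].
exact: continuous_norm_powR.
Qed.

Let continuous_expR_comp (f : R -> R) : continuous f ->
  continuous (fun u => expR (f u)).
Proof.
move=> cf u; apply: (@cvg_comp _ _ _ f (@expR R) _ (nbhs (f u))).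
  exact: cf.
exact: continuous_expR.
Qed.

Lemma mgf_orlicz_small : (1 <= alpha)%R -> (`|l| * K < 2^-1)%R ->
  'E_P[fun w => expR (l * X w)%R] <=
    (expR (16 * expR 1 * (l * K) ^+ 2))%:E.
Proof.
move=> a1 lK.
apply: (mgf_le_orlicz_norm (g := fun u => expR (16 * expR 1 * (l * u) ^+ 2)) X0 a1 Xoo).
  exact: (continuous_expR_comp continuous_gauss).
have cl : (`|l| * u)%R @[u --> K] --> (`|l| * K)%R.
  by apply: cvgM; [exact: cvg_cst|exact: cvg_id].
have near_lt : \forall u \near K, (`|l| * u < 2^-1)%R.
  exact: (@cvgr_lt R R (nbhs K) _ _ _ cl).
near=> u => u0; apply: mgf_dominated_small => //.
by rewrite normrM (gtr0_norm u0) ltW//; near: u.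
Unshelve. all: by end_near. Qed.

Lemma mgf_orlicz_gaussian : (2 <= alpha)%R ->
  'E_P[fun w => expR (l * X w)%R] <=
    (expR (16 * expR 1 * (l * K) ^+ 2))%:E.
Proof.
move=> a2; have a1 : (1 <= alpha)%R by lra.
apply: (mgf_le_orlicz_norm (g := fun u => expR (16 * expR 1 * (l * u) ^+ 2)) X0 a1 Xoo).
  exact: (continuous_expR_comp continuous_gauss).
by near=> u => u0; exact: mgf_dominated_gaussian.
Unshelve. all: by end_near. Qed.

Lemma mgf_orlicz_alpha_le2 : (1 < alpha <= 2)%R ->
  'E_P[fun w => expR (l * X w)%R] <=
    (expR (16 * expR 1 * (l * K) ^+ 2 +
      (alpha - 1) * (`|l * K| / alpha) `^ (alpha / (alpha - 1))))%:E.
Proof.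
move=> a12; have /andP[a1 a2] := a12; have a1' := ltW a1.
pose g u := expR (16 * expR 1 * (l * u) ^+ 2 +
   (alpha - 1) * (`|l * u| / alpha) `^ (alpha / (alpha - 1)))%R.
apply: (mgf_le_orlicz_norm (g := g) X0 a1' Xoo).
  apply: continuous_expR_comp => u; apply: cvgD; first exact: continuous_gauss.
  by apply: continuous_conj; rewrite ?divr_gt0//; lra.
by near=> u => u0; exact: mgf_dominated_alpha_le2.
Unshelve. all: by end_near. Qed.

Lemma mgf_orlicz_alpha_ge2 : (2 <= alpha)%R ->
  'E_P[fun w => expR (l * X w)%R] <=
    (expR ((alpha - 1) * expR (19 / (alpha - 1)) *
      (`|l * K| / alpha) `^ (alpha / (alpha - 1))))%:E.
Proof.
move=> a2; have a1 : (1 <= alpha)%R by lra.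
pose g u := expR ((alpha - 1) * expR (19 / (alpha - 1)) *
  (`|l * u| / alpha) `^ (alpha / (alpha - 1)))%R.
apply: (mgf_le_orlicz_norm (g := g) X0 a1 Xoo).
  apply: continuous_expR_comp; apply: continuous_conj; rewrite ?divr_gt0//; lra.
by near=> u => u0; exact: mgf_dominated_alpha_ge2.
Unshelve. all: by end_near. Qed.

End mgf_orlicz.

(** * Chernoff's bound for the weighted sum *)

Section tail.
Context d (T : measurableType d) (R : realType) (P : probability T R).
Variables (n : nat) (X : 'I_n -> {RV P >-> R}) (a : 'I_n -> R).
Hypothesis iX : independent_RVs X.

Lemma mgf_sum_le (l : R) (psi : 'I_n -> R) :
  (forall i, 'E_P[fun w => expR (l * a i * X i w)%R] <= (expR (psi i))%:E) ->
  'E_P[fun w => expR (l * \sum_(i < n) a i * X i w)%R] <=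
    (expR (\sum_(i < n) psi i))%:E.
Proof.
rewrite unlock => hpsi.
rewrite (eq_integral (fun w => (\prod_i expR (l * a i * X i w))%:E)); last first.
  move=> w _; rewrite mulr_sumr expR_sum; congr EFin.
  by apply: eq_bigr => i _; rewrite mulrA.
rewrite (integral_prod_independent (f := fun i x => expR (l * a i * x)))//; last 2 first.
- move=> i; apply: measurableT_comp => //; exact: measurable_funM.
- by move=> i; rewrite (le_lt_trans (hpsi i))// ltry.
rewrite expR_sum -prodEFin.
suff : 0 <= \prod_(i < n) \int[P]_w (expR (l * a i * X i w))%:E <=
    \prod_(i < n) (expR (psi i))%:E.
  by case/andP.
elim/big_ind2 : _ => [|x1 y1 x2 y2 /andP[x10 x1y] /andP[x20 x2y]|i _].
- by rewrite lexx lee01.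
- by rewrite mule_ge0//= lee_pmul.
- by rewrite hpsi andbT integral_ge0// => w _; rewrite lee_fin expR_ge0.
Qed.

Lemma prob_le_exp (Y : T -> R) (t c : R) : measurable_fun setT Y ->
  'E_P[fun w => expR (Y w)] <= (expR c)%:E ->
  P [set w | (t <= Y w)%R] <= (expR (c - t))%:E.
Proof.
rewrite unlock => mY Yc.
have mA : measurable [set w | (t <= Y w)%R].
  rewrite -[X in measurable X]setTI.
  exact: (measurable_fun_ler (measurable_cst t) mY).
have mE : measurable_fun setT (fun w => (expR (Y w))%:E).
  by apply/measurable_EFinP; exact: measurableT_comp.
rewrite -[X in P X]setIT -integral_indic// expRD EFinM -lee_pdivrMr ?expR_gt0//.
rewrite -expRN opprK muleC -ge0_integralZl//; last first.
  exact/measurable_EFinP/measurable_indic.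
apply: le_trans Yc; apply: ge0_le_integral => //.
- by apply: measurable_funeM; apply/measurable_EFinP; exact: measurable_indic.
- move=> w _; rewrite -EFinM lee_fin indicE.
  case: (boolP (_ \in _)) => [|_]; last by rewrite mulr0 expR_ge0.
  by rewrite inE/= => tY; rewrite mulr1 ler_expR.
Qed.

(** The hypothesis is for both signs of [l], as the two one-sided tails are
estimated separately. *)
Lemma tail_le_mgf (t lambda : R) (psi : 'I_n -> R) : (0 < lambda)%R ->
  (forall i l, `|l|%R = lambda ->
    'E_P[fun w => expR (l * a i * X i w)%R] <= (expR (psi i))%:E) ->
  P [set w | (t <= `|\sum_(i < n) a i * X i w|)%R] <=
    (2 * expR (\sum_(i < n) psi i - lambda * t))%:E.
Proof.
move=> l0 hpsi; set S := fun w => (\sum_(i < n) a i * X i w)%R.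
have mS : measurable_fun setT S.
  apply: measurable_sum => i; exact: measurable_funM.
have mlS (l : R) : measurable_fun setT (fun w => l * S w)%R.
  exact: measurable_funM.
have mA (l : R) : measurable [set w | (lambda * t <= l * S w)%R].
  rewrite -[X in measurable X]setTI.
  exact: (measurable_fun_ler (measurable_cst (lambda * t)%R) (mlS l)).
have bound l : `|l|%R = lambda ->
    P [set w | (lambda * t <= l * S w)%R] <=
    (expR (\sum_(i < n) psi i - lambda * t))%:E.
  move=> ll; apply: prob_le_exp => //; apply: mgf_sum_le => i; exact: hpsi.
have -> : [set w | (t <= `|S w|)%R] =
    [set w | (lambda * t <= lambda * S w)%R] `|`
    [set w | (lambda * t <= - lambda * S w)%R].
  apply/seteqP; split => w /=.
    rewrite mulNr -mulrN !ler_pM2l//.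
    by rewrite ler_normr => /orP[]; [left|right].
  by rewrite mulNr -mulrN !ler_pM2l// ler_normr => -[|] ->; rewrite ?orbT.
apply: (le_trans (measureU2 _ (mA _) (mA _))).
rewrite mulrDl mul1r EFinD; apply: leeD; apply: bound.
  by rewrite gtr0_norm.
by rewrite normrN gtr0_norm.
Qed.

End tail.

(** * Extended-real quotients and conjugate exponents *)

Section numeric.
Context {R : realType}.

(** With [lambda] proportional to [r / t], the part of the Chernoff exponent of
degree [b] in [lambda] is proportional to the left-hand side, hence at most a
multiple of [r], like [lambda * t]. The inequality is its last hypothesis raised
to the power [1 / (alpha - 1)]. *)
Lemma conjugate_cost_le (alpha t r S : R) : (1 < alpha)%R -> (0 < t)%R -> (0 < r)%R ->
  (0 <= S)%R ->
  let b := (alpha / (alpha - 1))%R in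
  (r * (S `^ b^-1) `^ alpha <= t `^ alpha)%R ->
  ((r / t) `^ b * S <= r)%R.
Proof.
move=> a1 t0 r0 S0 b h.
have aa : (0 < alpha - 1)%R by lra.
have aa0 : (alpha - 1 != 0)%R by rewrite gt_eqF.
have al0 : (alpha != 0)%R by rewrite gt_eqF//; lra.
have b0 : (b != 0)%R by rewrite mulf_neq0// invr_neq0.
have bE : (b = alpha * (alpha - 1)^-1)%R by [].
have bE1 : (b = 1 + (alpha - 1)^-1)%R by rewrite /b; field.
have h1 : (r `^ (alpha - 1)^-1 * S <= t `^ b)%R.
  have SE : (S = ((S `^ b^-1) `^ alpha) `^ (alpha - 1)^-1)%R.
    by rewrite -!powRrM -bE mulVf// powRr1.
  rewrite {1}SE -powRM ?powR_ge0 ?(ltW r0)// {2}bE powRrM.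
  by rewrite ge0_ler_powR ?nnegrE ?mulr_ge0 ?powR_ge0 ?invr_ge0 ?(ltW r0) ?(ltW aa).
have tb : (0 < t `^ b)%R by exact: powR_gt0.
rewrite -(ler_pM2r tb) mulrAC -powRM ?divr_ge0 ?(ltW r0) ?(ltW t0)//.
rewrite divfK ?gt_eqF// {1}bE1 powRD; last by rewrite (gt_eqF r0) implybT.
by rewrite powRr1 ?(ltW r0)// -mulrA ler_wpM2l// ltW.
Qed.

(** Holds also for [G = 0], where the quotient is infinite or 0. *)
Lemma le_div_ereal (x G r : R) : (0 <= x)%R -> (0 <= G)%R ->
  r%:E <= x%:E / G%:E -> (r * G <= x)%R.
Proof.
move=> x0 G0; rewrite inver; have [->|Gn] := eqVneq G 0%R.
  by rewrite mulr0.
by rewrite -EFinM lee_fin ler_pdivlMr// lt_neqAle eq_sym Gn.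
Qed.

(** An infinite [x] is reached as the limit of reals, the bound tending to 0. *)
Lemma le_expeR_reals (p x : \bar R) (C : R) : (0 < C)%R -> 0 <= x -> p <= 2%:E ->
  (forall r : R, (0 < r)%R -> r%:E <= x -> p <= (2 * expR (- (C * r)))%:E) ->
  p <= 2%:E * expeR (- (C%:E * x)).
Proof.
move=> C0; case: x => [x| |] //.
- rewrite lee_fin le_eqVlt => /predU1P[<- p2 _|x0 _ h].
    by rewrite mule0 oppe0 /= expR0 mule1.
  exact: (h x x0 (lexx _)).
- move=> _ _ h; rewrite gt0_muley ?lte_fin//= mule0.
  apply/lee_addgt0Pr => e e0; rewrite add0e.
  have r0 : (0 < 2 / (C * e))%R by rewrite divr_gt0// mulr_gt0.
  apply: (le_trans (h _ r0 (leey _))); rewrite lee_fin.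
  have -> : (C * (2 / (C * e)) = 2 / e)%R by field; rewrite !gt_eqF.
  have h1 : (expR (- (2 / e)) * (2 / e) <= 1)%R.
    rewrite -[leRHS](@expRxMexpNx_1 R (2 / e)) mulrC ler_wpM2r ?expR_ge0//.
    by have := expR_ge1Dx (2 / e)%R; lra.
  by move: h1; rewrite mulrA ler_pdivrMr// mul1r mulrC.
Qed.

Lemma conjugate_cases (alpha : R) (beta : \bar R) : (1 <= alpha)%R ->
  (alpha^-1)%:E + beta^-1 = 1 ->
  (alpha = 1%R /\ beta = +oo) \/
  ((1 < alpha)%R /\ beta = (alpha / (alpha - 1))%:E).
Proof.
move=> a1; case: beta => [b| |].
- rewrite inver; case: eqVneq => // b0 [] h; right.
  have a0 : (alpha != 0)%R by rewrite gt_eqF// (lt_le_trans ltr01).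
  have an1 : (alpha - 1 != 0)%R.
    apply/eqP => e; have e1 : alpha = 1%R by lra.
    move: h; rewrite e1 invr1 => h.
    have : (b^-1 = 0)%R by lra.
    by move/eqP; rewrite invr_eq0 (negbTE b0).
  split; first by rewrite lt_neqAle a1 andbT eq_sym -subr_eq0.
  congr EFin; apply: invr_inj.
  have -> : (b^-1 = 1 - alpha^-1)%R by lra.
  by field; rewrite a0 an1.
- rewrite invey adde0 => -[] h; left; split => //.
  by apply: invr_inj; rewrite invr1.
- by rewrite inveNy.
Qed.

End numeric.

(** * Choice of the Chernoff parameter *)

Section main.
Context d (T : measurableType d) (R : realType) (P : probability T R).
Variables (n : nat) (X : 'I_n -> {RV P >-> R}) (a : 'I_n -> R) (alpha : R).
Hypothesis iX : independent_RVs X.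
Hypothesis X0 : forall i, 'E_P[X i] = 0.
Hypothesis Xoo : forall i, orlicz_norm P alpha (X i) < +oo.
Let K i := fine (orlicz_norm P alpha (X i)).
Let G := (\sum_(i < n) a i ^+ 2 * K i ^+ 2)%R.
Let tail t := P [set w | (t <= `|\sum_(i < n) a i * X i w|)%R].

Let K0 i : (0 <= K i)%R.
Proof. by apply: fine_ge0; exact: orlicz_norm_ge0. Qed.

Let sqr_weight (l lambda : R) i : `|l|%R = lambda ->
  ((l * a i * K i) ^+ 2 = lambda ^+ 2 * (a i ^+ 2 * K i ^+ 2))%R.
Proof.
by move=> <-; rewrite real_normK ?num_real//; ring.
Qed.

Let powR_weight (l lambda b : R) i : (0 < alpha)%R -> `|l|%R = lambda ->
  ((`|l * a i * K i| / alpha) `^ b =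
   (lambda / alpha) `^ b * (`|a i| `^ b * K i `^ b))%R.
Proof.
move=> a0 <-; rewrite !normrM (ger0_norm (K0 i)).
have -> : (`|l| * `|a i| * K i / alpha = (`|l| / alpha) * (`|a i| * K i))%R by ring.
have la0 : (0 <= `|l| / alpha)%R by rewrite divr_ge0// ltW.
have aK0 : (0 <= `|a i| * K i)%R by rewrite mulr_ge0.
by rewrite (powRM _ la0 aK0) (powRM _ (normr_ge0 (a i)) (K0 i)).
Qed.

Let C0 : R := (16 * expR 1)%R.
Let C0ge : (32 <= C0)%R.
Proof. by rewrite /C0; have := @expR1_ge2 R; lra. Qed.

(** The parameter [lambda = r / (2 C0 t)] minimizes
[C0 * lambda^2 * t^2 / r - lambda * t]. *)
Lemma tail_gaussian (t r : R) : (2 <= alpha)%R -> (0 < t)%R -> (0 < r)%R ->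
  (r * G <= t ^+ 2)%R -> tail t <= (2 * expR (- (r / (4 * C0))))%:E.
Proof.
move=> a2 t0 r0 rG.
have C00 : (0 < C0)%R by have := C0ge; lra.
pose lambda := (r / t / (2 * C0))%R.
have l0 : (0 < lambda)%R by rewrite !divr_gt0// mulr_gt0.
pose psi i := (C0 * (lambda ^+ 2 * (a i ^+ 2 * K i ^+ 2)))%R.
apply: (le_trans (tail_le_mgf (psi := psi) iX t l0 _)).
  move=> i l ll; rewrite /psi -(sqr_weight _ ll); exact: mgf_orlicz_gaussian.
rewrite /psi lee_fin ler_wpM2l// ler_expR -!mulr_sumr -/G.
have -> : (lambda * t = r / (2 * C0))%R by rewrite /lambda; field; rewrite !gt_eqF.
have : (C0 * (lambda ^+ 2 * G) <= r / (4 * C0))%R.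
  have -> : (C0 * (lambda ^+ 2 * G) = (r * G) * (r / (4 * C0 * t ^+ 2)))%R.
    by rewrite /lambda; field; rewrite !gt_eqF.
  have -> : (r / (4 * C0) = t ^+ 2 * (r / (4 * C0 * t ^+ 2)))%R.
    by field; rewrite !gt_eqF.
  by rewrite ler_wpM2r// divr_ge0 ?mulr_ge0 ?sqr_ge0 ?ltW.
have -> : (r / (2 * C0) = 2 * (r / (4 * C0)))%R by field; rewrite gt_eqF.
lra.
Qed.

Let S b := (\sum_(i < n) `|a i| `^ b * K i `^ b)%R.

(** For [lambda / alpha = e^(-19) * (r / t)], the power [(lambda / alpha)^b] has
the factor [e^(-19 b)], which [e^(19 / (alpha - 1))] raises to [e^(-19)] since
[b = 1 + 1 / (alpha - 1)]. *)
Lemma tail_alpha_ge2 (t r : R) : (2 <= alpha)%R -> (0 < t)%R -> (0 < r)%R ->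
  let b := (alpha / (alpha - 1))%R in
  (r * (S b `^ b^-1) `^ alpha <= t `^ alpha)%R ->
  tail t <= (2 * expR (- (expR (- 19) * r)))%:E.
Proof.
move=> a2 t0 r0 b hr.
have a1 : (1 < alpha)%R by lra.
have aa : (0 < alpha - 1)%R by lra.
have al0 : (0 < alpha)%R by lra.
have S0 : (0 <= S b)%R by apply: sumr_ge0 => i _; rewrite mulr_ge0 ?powR_ge0.
have hS := conjugate_cost_le a1 t0 r0 S0 hr; rewrite -/b in hS.
pose lambda := (alpha * (expR (- 19) * (r / t)))%R.
have l0 : (0 < lambda)%R by rewrite !mulr_gt0 ?expR_gt0// invr_gt0.
have la : (lambda / alpha = expR (- 19) * (r / t))%R.
  by rewrite /lambda; field; rewrite !gt_eqF.
pose c := ((alpha - 1) * expR (19 / (alpha - 1)))%R.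
pose psi i := (c * ((lambda / alpha) `^ b * (`|a i| `^ b * K i `^ b)))%R.
apply: (le_trans (tail_le_mgf (psi := psi) iX t l0 _)).
  move=> i l ll; rewrite /psi -(powR_weight _ _ al0 ll); exact: mgf_orlicz_alpha_ge2.
rewrite /psi lee_fin ler_wpM2l// ler_expR -!mulr_sumr -/(S b) la.
have -> : (lambda * t = alpha * (expR (- 19) * r))%R.
  by rewrite /lambda; field; rewrite !gt_eqF.
rewrite powRM ?expR_ge0 ?divr_ge0 ?(ltW r0) ?(ltW t0)//.
rewrite -expRM -[(_ * _ * S b)%R]mulrA.
have cE : (c * expR (- 19 * b) = (alpha - 1) * expR (- 19))%R.
  rewrite /c -mulrA -expRD; congr (_ * expR _)%R.
  by rewrite /b; field; rewrite gt_eqF.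
rewrite mulrA cE.
have := ler_wpM2l (ltW (mulr_gt0 aa (expR_gt0 (- 19)))) hS.
set e := expR (- 19); lra.
Qed.

(** Small enough that the two quadratic costs [C0 * kappa^2] and [kappa^2] together
take half of the gain [kappa]. *)
Let kappa : R := (2 * (C0 + 1))^-1%R.

Let kappa_gt0 : (0 < kappa)%R.
Proof. by rewrite /kappa invr_gt0 mulr_gt0//; have := C0ge; lra. Qed.

Let kappaE : (kappa * (C0 + 1) = 2^-1)%R.
Proof.
by rewrite /kappa; field; rewrite gt_eqF//; have := C0ge; lra.
Qed.

Let kappa_cost r :
  (C0 * kappa ^+ 2 * r + kappa ^+ 2 * r = kappa / 2 * r)%R.
Proof.
have -> : (kappa / 2 = kappa * (kappa * (C0 + 1)))%R by rewrite kappaE.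
by ring.
Qed.

Let gaussian_cost_le (t r : R) : (0 < t)%R -> (0 < r)%R ->
  (r * G <= t ^+ 2)%R ->
  (C0 * ((kappa * (r / t)) ^+ 2 * G) <= C0 * kappa ^+ 2 * r)%R.
Proof.
move=> t0 r0 rG; rewrite -mulrA ler_wpM2l//; first by have := C0ge; lra.
have -> : ((kappa * (r / t)) ^+ 2 * G =
    kappa ^+ 2 * ((r * G) * (r / t ^+ 2)))%R.
  by field; rewrite gt_eqF.
rewrite ler_wpM2l ?sqr_ge0//.
apply: (@le_trans _ _ (t ^+ 2 * (r / t ^+ 2))%R).
  by rewrite ler_wpM2r// divr_ge0 ?sqr_ge0 ?(ltW r0).
by rewrite mulrC divfK// expf_neq0// gt_eqF.
Qed.

(** Since [b >= 2] and [kappa <= 1], the factor [kappa^b] is at most [kappa^2], with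
no dependence on [alpha]. *)
Lemma tail_alpha_le2 (t r : R) : (1 < alpha <= 2)%R -> (0 < t)%R -> (0 < r)%R ->
  let b := (alpha / (alpha - 1))%R in
  (r * G <= t ^+ 2)%R ->
  (r * (S b `^ b^-1) `^ alpha <= t `^ alpha)%R ->
  tail t <= (2 * expR (- (kappa / 2 * r)))%:E.
Proof.
move=> a12 t0 r0 b rG hr; have /andP[a1 a2] := a12.
have aa : (0 < alpha - 1)%R by lra.
have al0 : (0 < alpha)%R by lra.
have S0 : (0 <= S b)%R by apply: sumr_ge0 => i _; rewrite mulr_ge0 ?powR_ge0.
have hS := conjugate_cost_le a1 t0 r0 S0 hr; rewrite -/b in hS.
have k0 := kappa_gt0; have kE := kappaE; have C0g := C0ge.
have k1 : (kappa <= 1)%R by nra.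
pose lambda := (kappa * (r / t))%R.
have l0 : (0 < lambda)%R by rewrite mulr_gt0// divr_gt0.
pose psi i := (C0 * (lambda ^+ 2 * (a i ^+ 2 * K i ^+ 2)) +
  (alpha - 1) * ((lambda / alpha) `^ b * (`|a i| `^ b * K i `^ b)))%R.
apply: (le_trans (tail_le_mgf (psi := psi) iX t l0 _)).
  move=> i l ll; rewrite /psi -(powR_weight _ _ al0 ll) -(sqr_weight _ ll).
  exact: mgf_orlicz_alpha_le2.
rewrite /psi lee_fin ler_wpM2l// ler_expR big_split/= -!mulr_sumr -/(S b) -/G.
have -> : (lambda * t = kappa * r)%R by rewrite /lambda; field; rewrite !gt_eqF.
have h1 := gaussian_cost_le t0 r0 rG; rewrite -/lambda in h1.
have h2 : ((alpha - 1) * ((lambda / alpha) `^ b * S b) <= kappa ^+ 2 * r)%R.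
  have b2 : (2 <= b)%R by rewrite /b ler_pdivlMr//; lra.
  have b0 : (0 <= b)%R by lra.
  have rt : (0 <= r / t)%R by rewrite divr_ge0 ?ltW.
  have h3 : ((lambda / alpha) `^ b <= kappa ^+ 2 * (r / t) `^ b)%R.
    apply: (@le_trans _ _ (lambda `^ b)%R).
      have la : (lambda / alpha <= lambda)%R.
        by rewrite ler_pdivrMr// ler_peMr ?(ltW l0)// ltW.
      by apply: ge0_ler_powR; rewrite ?nnegrE ?divr_ge0 ?(ltW l0) ?(ltW al0) ?(ltW aa).
    rewrite /lambda powRM ?(ltW k0)// ler_wpM2r ?powR_ge0//.
    by rewrite -powR_mulrn ?(ltW k0)// ger_powR// k0.
  have h4 : (0 <= (lambda / alpha) `^ b * S b)%R by rewrite mulr_ge0 ?powR_ge0.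
  apply: (@le_trans _ _ ((lambda / alpha) `^ b * S b)%R); first by nra.
  apply: (@le_trans _ _ (kappa ^+ 2 * (r / t) `^ b * S b)%R).
    by rewrite ler_wpM2r.
  by rewrite -mulrA ler_wpM2l// sqr_ge0.
have h5 := kappa_cost r.
lra.
Qed.

(** Here the moment generating functions are only controlled for
[|l a_i| K_i < 1/2], which the bound on the maximum ensures. *)
Lemma tail_alpha1 (t r : R) : alpha = 1%R -> (0 < t)%R -> (0 < r)%R ->
  (r * G <= t ^+ 2)%R ->
  (r * \big[Num.max/0]_(i < n) (`|a i| * K i) <= t)%R ->
  tail t <= (2 * expR (- (kappa / 2 * r)))%:E.
Proof.
move=> a1 t0 r0 rG hr.
have k0 := kappa_gt0; have kE := kappaE; have C0g := C0ge.
pose lambda := (kappa * (r / t))%R.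
have l0 : (0 < lambda)%R by rewrite mulr_gt0// divr_gt0.
pose psi i := (C0 * (lambda ^+ 2 * (a i ^+ 2 * K i ^+ 2)))%R.
apply: (le_trans (tail_le_mgf (psi := psi) iX t l0 _)).
  move=> i l ll; rewrite /psi -(sqr_weight _ ll); apply: mgf_orlicz_small => //.
    by rewrite a1.
  rewrite -/(K i) normrM ll.
  apply: (@le_lt_trans _ _ kappa); last by nra.
  rewrite /lambda -mulrA -[leRHS]mulr1 -mulrA ler_wpM2l ?(ltW k0)//.
  rewrite mulrAC ler_pdivrMr// mul1r; apply: le_trans hr.
  rewrite ler_wpM2l ?(ltW r0)//.
  exact: (le_bigmax _ (fun i => `|a i| * K i)%R).
rewrite /psi lee_fin ler_wpM2l// ler_expR -!mulr_sumr -/G.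
have -> : (lambda * t = kappa * r)%R by rewrite /lambda; field; rewrite !gt_eqF.
have h1 := gaussian_cost_le t0 r0 rG; rewrite -/lambda in h1.
have h5 := kappa_cost r.
have : (0 <= kappa ^+ 2 * r)%R by rewrite mulr_ge0 ?sqr_ge0 ?ltW.
lra.
Qed.

End main.

(* The quotients are taken in \bar R, where t / 0 = +oo for t > 0, 0 / 0 = 0
   and expeR -oo = 0. *)
Theorem theorem1 (R : realType) :
  exists C1 C2 : R, (0 < C1)%R /\ (0 < C2)%R /\
  forall (alpha : R) (beta : \bar R), (1 <= alpha)%R ->
    (alpha^-1)%:E + beta^-1 = 1 ->
  forall (d : measure_display) (T : measurableType d) (P : probability T R)
    (n : nat) (X : 'I_n -> {RV P >-> R}) (a : 'I_n -> R),
    independent_RVs X ->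
    (forall i, 'E_P[X i] = 0) ->
    (forall i, orlicz_norm P alpha (X i) < +oo) ->
  forall t : R, (0 <= t)%R ->
    let K := fun i => fine (orlicz_norm P alpha (X i)) in
    let gaussian_term :=
      (t ^+ 2)%:E / (\sum_(i < n) a i ^+ 2 * K i ^+ 2)%R%:E in
    let alpha_term := (t `^ alpha)%:E / (weighted_lnorm beta a K `^ alpha)%:E in
    let tail := P [set w | (t <= `|\sum_(i < n) a i * X i w|)%R] in
    ((2 <= alpha)%R ->
      tail <= 2%:E * expeR (- (C1%:E * maxe gaussian_term alpha_term))) /\
    ((alpha <= 2)%R ->
      tail <= 2%:E * expeR (- (C2%:E * mine gaussian_term alpha_term))).
Proof.
(* [C1] serves for both terms because [1 / (4 * 16 e) >= e^(-19)]. *)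
exists (expR (- 19)), ((2 * (16 * expR 1 + 1))^-1 / 2)%R.
have C2gt0 : (0 < (2 * (16 * expR 1 + 1))^-1 / 2 :> R)%R.
  by rewrite divr_gt0// invr_gt0 mulr_gt0// addr_gt0// mulr_gt0// expR_gt0.
split; first exact: expR_gt0.
split=> // alpha beta a1 ab d T P n X a iX X0 Xoo t t0 K gaussian_term alpha_term tail.
have G0 : (0 <= \sum_(i < n) a i ^+ 2 * K i ^+ 2)%R.
  by apply: sumr_ge0 => i _; rewrite mulr_ge0 ?sqr_ge0.
have N0 : (0 <= weighted_lnorm beta a K `^ alpha)%R by exact: powR_ge0.
have g0 : 0 <= gaussian_term.
  by rewrite mule_ge0 ?inve_ge0 ?lee_fin ?sqr_ge0.
have al0 : 0 <= alpha_term.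
  by rewrite mule_ge0 ?inve_ge0 ?lee_fin ?powR_ge0.
have tail2 : tail <= 2%:E.
  apply: (@le_trans _ _ 1); last by rewrite lee_fin ler1n.
  have mS : measurable_fun setT (fun w => `|\sum_(i < n) a i * X i w|%R).
    apply: measurableT_comp => //; apply: measurable_sum => i.
    exact: measurable_funM.
  apply: probability_le1; rewrite -[X in measurable X]setTI.
  exact: (measurable_fun_ler (measurable_cst t) mS).
have tpos r : (0 < r)%R -> r%:E <= gaussian_term \/ r%:E <= alpha_term -> (0 < t)%R.
  move=> r0; move: t0; rewrite le_eqVlt => /predU1P[t0|//].
  rewrite /gaussian_term /alpha_term -t0 expr0n powR0/=; last first.
    by rewrite gt_eqF// (lt_le_trans ltr01).
  by rewrite !mul0e !lee_fin leNgt r0 => -[].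
have rG r : r%:E <= gaussian_term -> (r * (\sum_(i < n) a i ^+ 2 * K i ^+ 2) <= t ^+ 2)%R.
  by apply: le_div_ereal => //; rewrite sqr_ge0.
have rN r : r%:E <= alpha_term -> (r * (weighted_lnorm beta a K `^ alpha) <= t `^ alpha)%R.
  by apply: le_div_ereal => //; rewrite powR_ge0.
split=> a2.
  apply: le_expeR_reals; rewrite ?expR_gt0 ?le_max ?g0// => r r0.
  rewrite le_max => /orP[rg|ra].
    have tt := tpos _ r0 (or_introl rg).
    apply: (le_trans (tail_gaussian iX X0 Xoo a2 tt r0 (rG _ rg))).
    rewrite lee_fin ler_wpM2l// ler_expR lerN2 [leRHS]mulrC ler_wpM2r ?(ltW r0)//.
    rewrite expRN lef_pV2 ?posrE ?expR_gt0 ?mulr_gt0 ?expR_gt0//.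
    apply: (@le_trans _ _ (2 ^+ 6 * expR 1)%R); first by lra.
    rewrite (_ : 19 = 18 + 1 :> R)%R; last by lra.
    rewrite expRD ler_wpM2r ?expR_ge0//.
    by apply: (le_trans (exp2_le_expR 6)); rewrite ler_expR; lra.
  have tt := tpos _ r0 (or_intror ra).
  have [[e _]|[a1' bE]] := conjugate_cases a1 ab; first by exfalso; lra.
  apply: (tail_alpha_ge2 iX X0 Xoo a2 tt r0).
  by have := rN _ ra; rewrite bE.
apply: le_expeR_reals; rewrite ?le_min ?g0 ?al0// => r r0.
rewrite le_min => /andP[rg ra].
have tt := tpos _ r0 (or_introl rg).
have [[e bE]|[a1' bE]] := conjugate_cases a1 ab.
  apply: (tail_alpha1 iX X0 Xoo e tt r0 (rG _ rg)).
  have M0 : (0 <= \big[Num.max/0]_(i < n) (`|a i| * K i))%R.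
    exact: bigmax_ge_id.
  (* The norms in the goal depend on [alpha], so only [h] is rewritten. *)
  have h := rN _ ra; rewrite bE e /weighted_lnorm (powRr1 t0) in h.
  by rewrite (powRr1 M0) in h.
have a12 : (1 < alpha <= 2)%R by rewrite a1'.
apply: (tail_alpha_le2 iX X0 Xoo a12 tt r0 (rG _ rg)).
by have := rN _ ra; rewrite bE.
Qed.
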